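(* For every $\varepsilon>0$ there exists $\Delta_0$ such that every triangle-free graph $G$ of maximum degree $\Delta \ge \Delta_0$ satisfies $\vec{\chi}(G) \le (1+\varepsilon) \frac{\Delta}{2\ln \Delta}$. (That is, $\vec\chi(G)\le (1+o(1))\frac{\Delta}{2\ln\Delta}$ as $\Delta\to\infty$.)
   Context: For an undirected graph $G$, $\vec\chi(G)$ is the maximum, over all orientations $\vec G$ of $G$, of the dichromatic number of $\vec G$; the dichromatic number of a digraph is the least $k$ such that its vertex set can be partitioned into $k$ sets each inducing a subdigraph with no directed cycle. *)

(* Defs.v *)
From mathcomp Require Import all_boot all_order all_algebra.
From mathcomp Require Import boolp.
Set Implicit Arguments.
Unset Strict Implicit.
Unset Printing Implicit Defensive.

Section Digraphs.
Variable T : finType.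

(* A digraph on T is given by its set of arcs. *)
Definition arc (D : {set T * T}) : rel T := fun x y => (x, y) \in D.

(* A directed cycle is a nonempty sequence of pairwise distinct vertices, each
   joined by an arc to the cyclically next one; [:: x] is a cycle iff x carries
   a loop, and [:: x; y] iff both (x, y) and (y, x) are arcs. *)
Definition acyclic_in (D : {set T * T}) (A : {set T}) : Prop :=
  forall c : seq T, c != [::] -> {subset c <= A} -> ~ ucycle (arc D) c.

Definition acyclic_partition (D : {set T * T}) (P : {set {set T}}) : bool :=
  partition P [set: T] && `[< forall A, A \in P -> acyclic_in D A >].

(* The partition into singletons only serves as the witness required by arg min:
   it is an acyclic partition as soon as D has no loops. *)
Definition dichromatic (D : {set T * T}) : nat :=
  #|[arg min_(P < [set [set x] | x : T] | acyclic_partition D P) #|P| ]|.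

End Digraphs.

Section Graphs.
Variables (T : finType) (e : rel T).

Definition orientation (D : {set T * T}) : bool :=
  [forall x, forall y,
    (e x y == arc D x y || arc D y x) && ~~ (arc D x y && arc D y x)].

Definition oriented_chi : nat :=
  \max_(D : {set T * T} | orientation D) dichromatic D.

Definition max_degree : nat := \max_(x : T) #|[set y | e x y]|.

Definition triangle_free : Prop :=
  forall x y z, ~ [/\ e x y, e y z & e z x].

End Graphs.

Section DichromaticSpec.
Variables (T : finType) (e : rel T).

Lemma orientation_loopless (D : {set T * T}) x : orientation e D -> ~~ arc D x x.
Proof. by move=> /forallP/(_ x)/forallP/(_ x)/andP[_]; rewrite andbb. Qed.

Lemma acyclic_partition_singletons (D : {set T * T}) :
  (forall x, ~~ arc D x x) -> acyclic_partition D [set [set x] | x : T].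
Proof.
move=> nl; apply/andP; split.
  apply/and3P; split.
  - apply/eqP/setP => x; rewrite inE; apply/bigcupP; exists [set x].
      exact: imset_f.
    exact: set11.
  - apply/trivIsetP => _ _ /imsetP[x _ ->] /imsetP[y _ ->] nxy.
    by rewrite disjoints1 inE; apply: contraNneq nxy => ->.
  - by apply/imsetP => -[x _ /setP/(_ x)]; rewrite !inE eqxx.
apply/asboolP => _ /imsetP[x _ ->] [//|y [|z c]] _ sub /andP[cyc un].
  by move: cyc; rewrite /= andbT (negPf (nl y)).
have /set1P yx := sub y (mem_head _ _).
have /set1P zx : z \in [set x] by apply: sub; rewrite !inE eqxx orbT.
by move: un; rewrite yx zx /= inE eqxx.
Qed.

Lemma dichromaticP (D : {set T * T}) : orientation e D ->
  (exists2 P, acyclic_partition D P & #|P| = dichromatic D) /\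
  (forall P, acyclic_partition D P -> dichromatic D <= #|P|).
Proof.
move=> oD; rewrite /dichromatic; case: arg_minnP => [|P aP minP].
  by apply: acyclic_partition_singletons => x; apply: orientation_loopless oD.
by split; [exists P | exact: minP].
Qed.

End DichromaticSpec.

(* Main.v *)
(** Let [F] be a maximum acyclic set of arcs of an orientation [D].  At each vertex
    [F] holds at least half of the arcs of [D], so the graph [B] underlying
    [D :\: F] has maximum degree at most Delta / 2; a proper coloring of [B] leaves
    only arcs of [F] inside the color classes, which are therefore acyclic.

    It remains to color the triangle-free graph [B] as in the Johansson-Molloy
    theorem, for which we follow Martinsson's version of Rosenfeld's counting
    argument.  Among the functions [T -> C], let [count S] be the number of those
    that are proper on [S].  By induction on [S],
    [l * count (S :\ v) <= #|C| * count S] for all [v] in [S]: for a random [f]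
    proper on [S :\ v], the induction hypothesis makes it unlikely that many
    neighbors of [v] have at most [t] available colors; since the neighborhood of
    [v] is independent, its colors can be resampled independently, each uniformly
    among the available ones, and by convexity many colors stay free at [v]. *)

Require Import Defs.
From mathcomp Require Import all_boot all_order all_algebra.
From mathcomp Require Import boolp reals sequences exp.
From mathcomp Require Import zify ring lra.
Import Order.TTheory GRing.Theory Num.Theory.

Set Implicit Arguments.
Unset Strict Implicit.
Unset Printing Implicit Defensive.

(* [path.arc] shadows [Defs.arc] otherwise. *)
Import Defs.

(** * Maximum acyclic arc sets and the reduction to proper coloring *)

Section FeedbackArcs.
Variable T : finType.
Implicit Types (D F : {set T * T}) (e : rel T) (v x y : T) (A : {set T}).

Definition symm_arc D : rel T := fun x y => arc D x y || arc D y x.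

Lemma acyclic_in_arcs_setT D F A :
    acyclic_in F [set: T] ->
    {in A &, forall x y, arc D x y -> arc F x y} ->
  acyclic_in D A.
Proof.
move=> acF DF c c0 cA /andP[cyc un].
apply: (acF c c0) => [?|]; first by rewrite inE.
apply/andP; split=> //.
by apply: sub_in_cycle cyc; [exact: DF | apply/allP => x /cA].
Qed.

Lemma dichromatic_leq_colors e D k (f : T -> 'I_k) :
    orientation e D ->
    (forall c, acyclic_in D [set x | f x == c]) ->
  dichromatic D <= k.
Proof.
move=> oD acf.
have /(proj2 (dichromaticP oD)) le : acyclic_partition D (preim_partition f setT).
  rewrite /acyclic_partition preim_partitionP; apply/asboolP.
  move=> _ /imsetP[x _ ->] c c0 cA; apply: (acf (f x) c c0) => y /cA.
  by rewrite !inE eq_sym.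
apply: leq_trans le _.
have -> : preim_partition f setT =
    (fun c => [set y in setT | c == f y]) @: (f @: [set: T]).
  by rewrite -imset_comp.
apply: leq_trans (leq_imset_card _ _) _.
by rewrite -[leqRHS]card_ord max_card.
Qed.

Definition arcs_at v D := [set a in D | (a.1 == v) || (a.2 == v)].
Definition arcs_from v D := [set a in D | a.1 == v].
Definition arcs_to v D := [set a in D | a.2 == v].
Definition other_end v (a : T * T) := if a.1 == v then a.2 else a.1.

(** Every arc now present at [v] leaves [v], so no cycle can enter [v]; a cycle that avoids [v] uses
    arcs of [F] only. The next lemma is the dual, with [v] a sink. *)
Lemma acyclic_reset_from D F v : (forall x, ~~ arc D x x) ->
  acyclic_in F setT -> acyclic_in ((F :\: arcs_at v F) :|: arcs_from v D) setT.
Proof.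
move=> nl acF c c0 _ /andP[cyc un].
have [vc|nvc] := boolP (v \in c).
  have := prev_cycle cyc vc; rewrite /arc !inE /= eqxx orbT andbT.
  case/orP=> [/andP[/negP ? //]|/andP[+ /eqP pv]].
  by apply/negP; have := nl v; rewrite /arc -{1}pv.
apply: (acF c c0) => [?|]; first by rewrite inE.
apply/andP; split=> //.
apply: (@sub_in_cycle _ (predC1 v)) cyc.
  move=> x y; rewrite /arc !inE /= => /negPf xv /negPf yv.
  by rewrite xv yv !andbF /= orbF.
by apply/allP => x xc /=; apply: contraNneq nvc => <-.
Qed.

Lemma acyclic_reset_to D F v : (forall x, ~~ arc D x x) ->
  acyclic_in F setT -> acyclic_in ((F :\: arcs_at v F) :|: arcs_to v D) setT.
Proof.
move=> nl acF c c0 _ /andP[cyc un].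
have [vc|nvc] := boolP (v \in c).
  have := next_cycle cyc vc; rewrite /arc !inE /= eqxx /= andbT.
  case/orP=> [/andP[/negP ? //]|/andP[+ /eqP pv]].
  by apply/negP; have := nl v; rewrite /arc -{2}pv.
apply: (acF c c0) => [?|]; first by rewrite inE.
apply/andP; split=> //.
apply: (@sub_in_cycle _ (predC1 v)) cyc.
  move=> x y; rewrite /arc !inE /= => /negPf xv /negPf yv.
  by rewrite xv yv !andbF /= orbF.
by apply/allP => x xc /=; apply: contraNneq nvc => <-.
Qed.


(** Two arcs at [v] with the same other end are equal or antiparallel, and an orientation has no
    antiparallel pairs. *)
Lemma other_end_inj e D v :
  orientation e D -> {in arcs_at v D &, injective (other_end v)}.
Proof.
move=> oD [a b] [c d]; rewrite !inE /other_end /=.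
move=> /andP[abD hab] /andP[cdD hcd].
have no2 x y : (x, y) \in D -> (y, x) \in D -> False.
  move/forallP: oD => /(_ x)/forallP/(_ y)/andP[_]; rewrite /arc => /negP h ? ?.
  by apply: h; apply/andP.
case: eqP hab abD => [->|_] /= hab abD; case: eqP hcd cdD => [->|_] /= hcd cdD.
- by move=> ->.
- by move: abD cdD; rewrite (eqP hcd) => + + cb; rewrite cb => h1 h2; case: (no2 _ _ h1 h2).
- by move: abD cdD; rewrite (eqP hab) => + + cb; rewrite cb => h1 h2; case: (no2 _ _ h1 h2).
- by move=> ->; rewrite (eqP hab) (eqP hcd).
Qed.

Lemma card_symm_arc D v : #|[set y | symm_arc D v y]| <= #|arcs_at v D|.
Proof.
apply: leq_trans (leq_imset_card (other_end v) _).
apply/subset_leq_card/subsetP => y; rewrite inE => /orP[]h; apply/imsetP.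
  by exists (v, y); rewrite ?inE /other_end /= eqxx // andbT.
exists (y, v); rewrite ?inE /other_end /= ?eqxx ?orbT ?andbT //.
by case: eqP.
Qed.

Lemma card_arcs_at e D v : orientation e D -> #|arcs_at v D| <= #|[set y | e v y]|.
Proof.
move=> oD; rewrite -(card_in_imset (@other_end_inj e D v oD)).
have eD x y : arc D x y || arc D y x -> e x y.
  by move/forallP: oD => /(_ x)/forallP/(_ y)/andP[/eqP ->].
apply/subset_leq_card/subsetP => _ /imsetP[[a b] + ->].
rewrite !inE /other_end /= => /andP[abD].
by case: (eqVneq a v) => [<- _|_ /= /eqP <-]; apply: eD; rewrite /arc abD ?orbT.
Qed.

(* At a vertex [v] a maximum acyclic [F] must hold at least half of the arcs of
   [D]: making [v] a source, or a sink, keeps [F] acyclic. *)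
Lemma exists_sparse_feedback_arc_set e D : orientation e D ->
  exists2 F : {set T * T}, F \subset D & acyclic_in F setT /\
    forall v, 2 * #|[set y | symm_arc (D :\: F) v y]| <= #|[set y | e v y]|.
Proof.
move=> oD; have nl x : ~~ arc D x x := orientation_loopless x oD.
pose P F := (F \subset D) && `[< acyclic_in F [set: T] >].
have P0 : P set0.
  rewrite /P sub0set; apply/asboolP => [[//|x c]] _ _ /andP[cyc _].
  by have := next_cycle cyc (mem_head x c); rewrite /arc inE.
case: (arg_maxnP (fun F => #|F|) P0) => F /andP[FD /asboolP acF] maxF.
exists F => //; split=> // v.
apply: leq_trans (card_arcs_at v oD).
have atFD : arcs_at v F \subset arcs_at v D.
  by apply/subsetP => a; rewrite !inE => /andP[/(subsetP FD)-> ->].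
(* Exchange argument: replacing the arcs of [F] at [v] by [X] gives another acyclic subset of [D],
   which by maximality is no larger than [F]. *)
have half (X : {set T * T}) : X \subset arcs_at v D ->
    acyclic_in ((F :\: arcs_at v F) :|: X) setT -> #|X| <= #|arcs_at v F|.
  move=> XD acX.
  have /maxF : P ((F :\: arcs_at v F) :|: X).
    rewrite /P; apply/andP; split; last exact/asboolP.
    rewrite subUset (subset_trans (subsetDl _ _) FD) (subset_trans XD) //.
    by apply/subsetP => a; rewrite inE => /andP[].
  have /eqP XF0 : (F :\: arcs_at v F) :&: X == set0.
    rewrite setI_eq0; apply/pred0P => a /=; apply/negP => /andP[].
    case/setDP=> aF; rewrite inE aF /= => /negPf nat /(subsetP XD).
    by rewrite inE nat andbF.
  have atF : arcs_at v F \subset F by apply/subsetP => a; rewrite inE => /andP[].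
  have := cardsD F (arcs_at v F); rewrite (setIidPr atF).
  have := subset_leq_card atF.
  rewrite cardsU XF0 cards0 => /=; lia.
have from : #|arcs_from v D| <= #|arcs_at v F|.
  apply: half (acyclic_reset_from nl acF).
  by apply/subsetP => a; rewrite !inE => /andP[-> ->].
have to : #|arcs_to v D| <= #|arcs_at v F|.
  apply: half (acyclic_reset_to nl acF).
  by apply/subsetP => a; rewrite !inE => /andP[-> ->]; rewrite orbT.
have DU : arcs_at v D = arcs_from v D :|: arcs_to v D.
  by apply/setP => a; rewrite !inE andb_orr.
have := card_symm_arc (D :\: F) v.
have -> : arcs_at v (D :\: F) = arcs_at v D :\: arcs_at v F.
  by apply/setP => a; rewrite !inE; case: (a \in F) (a \in D) (_ || _) => [] [] [].
rewrite cardsD (setIidPr atFD).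
move: (subset_leq_card atFD) (leq_card_setU (arcs_from v D) (arcs_to v D)).1.
rewrite -DU; lia.
Qed.

Lemma dichromatic_leq_sparse_coloring e D k : orientation e D ->
  (forall B : rel T, symmetric B -> (forall x y, B x y -> e x y) ->
     (forall v, 2 * #|[set y | B v y]| <= #|[set y | e v y]|) ->
     exists f : T -> 'I_k, forall x y, B x y -> f x != f y) ->
  dichromatic D <= k.
Proof.
move=> oD col; have [F FD [acF deg]] := exists_sparse_feedback_arc_set oD.
have [||//|f propf] := col (symm_arc (D :\: F)).
- by move=> x y; rewrite /symm_arc orbC.
- move=> x y; move/forallP: oD => /(_ x)/forallP/(_ y)/andP[/eqP -> _].
  by rewrite /symm_arc /arc !inE => /orP[]/andP[_ ->]; rewrite ?orbT.
apply: (dichromatic_leq_colors (f := f) oD) => c.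
apply: (acyclic_in_arcs_setT acF) => x y; rewrite !inE => /eqP fx /eqP fy xyD.
apply: contraT => nF; have := propf x y; rewrite fx fy eqxx.
by apply; rewrite /symm_arc /arc inE nF [_ \in D]xyD.
Qed.

End FeedbackArcs.
Local Open Scope ring_scope.

(** * Expected number of colors missed by independent uniform choices from lists *)

Section LocalEstimate.
Variable R : realType.

(** With [x = (1 + t^-1) * p], the bound [1 + x <= expR x] leaves [1 <= (1 + x) * (1 - p)] to check,
    which follows from [p <= 1 / (t + 1)]. *)
Lemma expR_le_1subp (t p : R) :
  0 < t -> 0 <= p -> p * (t + 1) <= 1 -> expR (- ((1 + t^-1) * p)) <= 1 - p.
Proof.
move=> t0 p0 pt.
have s0 : 0 < t^-1 by rewrite invr_gt0.
have p1 : 0 < 1 - p by nra.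
rewrite expRN invf_ple ?posrE ?expR_gt0 //.
apply: le_trans (expR_ge1Dx _).
rewrite -[_^-1]mul1r ler_pdivrMr //.
have st : t^-1 * t = 1 by rewrite mulVf ?gt_eqF.
have : p * (t^-1 * (p * (t + 1))) <= p * (t^-1 * 1).
  by apply: ler_wpM2l => //; apply: ler_wpM2l => //; exact: ltW.
by nra.
Qed.

(** Weierstrass product inequality; the induction also carries that the product lies between 0 and
    1. *)
Lemma ler_1subsum_prod (I : finType) (P : pred I) (p : I -> R) :
  (forall i, P i -> 0 <= p i <= 1) ->
  1 - \sum_(i | P i) p i <= \prod_(i | P i) (1 - p i).
Proof.
move=> p01.
suff [] : 1 - \sum_(i | P i) p i <= \prod_(i | P i) (1 - p i) /\
    0 <= \prod_(i | P i) (1 - p i) <= 1 by [].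
elim/big_rec2: _ => [|i x y /p01/andP[p0 p1] [le /andP[x0 x1]]].
  by rewrite subr0 lexx ler01.
by split; nra.
Qed.

Variables (T C : finType).

(** After division by the product of the list sizes, the right side is the expected number of colors
    chosen by no [u] in [N] when each picks uniformly from [L u]. Short lists are handled by a union
    bound, long ones by an exponential bound on each factor. *)
Lemma sum_prod_avoid_ge (N : {set T}) (L : T -> {set C}) (d b : R) (t : nat) :
    (0 < t)%N -> b < 1 -> (0 < #|C|)%N -> #|N|%:R <= d ->
    #|[set u in N | (#|L u| <= t)%N]|%:R <= b * #|C|%:R ->
  (1 - b) * #|C|%:R * expR (- ((1 + t%:R^-1) * d / ((1 - b) * #|C|%:R)))
    * \prod_(u in N) #|L u|%:R <= \sum_c \prod_(u in N) #|L u :\ c|%:R.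
Proof.
move=> t0 b1 C0 Nd bad.
have [/existsP[u /andP[uN /eqP Lu0]]|/existsPn L0] :=
    boolP [exists u, (u \in N) && (L u == set0)].
  rewrite (bigD1 u) //= Lu0 cards0 mul0r mulr0.
  by apply: sumr_ge0 => c _; apply: prodr_ge0.
have {}L0 u : u \in N -> (#|L u|%:R : R) != 0.
  by move=> uN; have := L0 u; rewrite uN /= pnatr_eq0 cards_eq0.
(* The probability that [u] picks [c]. *)
pose p u c : R := (c \in L u)%:R / #|L u|%:R.
have p01 u c : 0 <= p u c <= 1.
  rewrite /p; case: (boolP (c \in L u)) => cL; last by rewrite mul0r lexx ler01.
  rewrite mul1r invr_ge0 ler0n invf_le1 ?ltr0n ?ler1n ?card_gt0;
  by apply/set0Pn; exists c.
have sump u : u \in N -> \sum_c p u c = 1.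
  move=> uN; rewrite -mulr_suml -natr_sum.
  rewrite [X in X%:R](_ : _ = #|L u|) ?mulfV ?L0 //.
  by rewrite -sum1_card [RHS]big_mkcond /=; apply: eq_bigr => c _; case: ifP.
have -> : \sum_c \prod_(u in N) #|L u :\ c|%:R =
    (\sum_c \prod_(u in N) (1 - p u c)) * \prod_(u in N) #|L u|%:R.
  rewrite mulr_suml; apply: eq_bigr => c _; rewrite -big_split /=.
  apply: eq_bigr => u uN; rewrite mulrBl mul1r mulfVK ?L0 //.
  by rewrite [in RHS](cardsD1 c) natrD [RHS]addrAC subrr add0r.
apply: ler_wpM2r; first exact: prodr_ge0.
pose good u := (t < #|L u|)%N.
(* [w c] is the probability that no short-list vertex picks [c], and [expR (- y c)] bounds from
   below the same probability for the long lists. *)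
pose w c := \prod_(u in N | ~~ good u) (1 - p u c).
pose y c := (1 + t%:R^-1) * \sum_(u in N | good u) p u c.
set W0 := (1 - b) * #|C|%:R; set a := _ * d / W0.
have W00 : 0 < W0 by rewrite mulr_gt0 ?ltr0n // subr_gt0.
have w0 c : 0 <= w c.
  by apply: prodr_ge0 => u _; rewrite subr_ge0; case/andP: (p01 u c).
have s0 : 0 < (1 + t%:R^-1 : R) by rewrite addr_gt0 ?invr_gt0 ?ltr0n.
have y0 c : 0 <= y c.
  by apply: mulr_ge0 (ltW s0) (sumr_ge0 _ _) => u _; case/andP: (p01 u c).
have wy c : w c * expR (- y c) <= \prod_(u in N) (1 - p u c).
  rewrite [leRHS](bigID good) /= mulrC ler_wpM2r //.
  rewrite /y mulr_sumr -sumrN expR_sum; apply: ler_prod => u /andP[uN gu].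
  rewrite expR_ge0 /=; apply: expR_le_1subp; rewrite ?ltr0n //.
    by case/andP: (p01 u c).
  rewrite /p; case: (c \in L u); last by rewrite !mul0r ler01.
  rewrite mul1r ler_pdivrMl ?mulr1 -?natr1 ?ler_nat ?ltr0n //.
    by rewrite natr1 ler_nat.
  exact: leq_trans gu.
apply: le_trans (ler_sum _ (fun c _ => wy c)).
(* Each short-list vertex costs total weight at most 1, and there are at most [b * #|C|] of them. *)
have W : W0 <= \sum_c w c.
  have le c : 1 - \sum_(u in N | ~~ good u) p u c <= w c.
    exact: ler_1subsum_prod.
  apply: le_trans (ler_sum _ (fun c _ => le c)).
  rewrite sumrB sumr_const exchange_big /=.
  rewrite (eq_bigr (fun=> 1)); last by move=> u /andP[/sump].
  rewrite sumr_const /W0 mulrBl mul1r lerB //.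
  apply: le_trans bad; rewrite ler_nat; apply/eq_leq/eq_card => u.
  by rewrite !inE /in_mem /= leqNgt.
have Y : \sum_c w c * y c <= a * W0.
  have le c : w c * y c <= y c.
    rewrite ler_piMl //; apply: prodr_ile1 => u _.
    by case/andP: (p01 u c) => ? ?; rewrite subr_ge0 gerBl; apply/andP.
  apply: le_trans (ler_sum _ (fun c _ => le c)) _.
  rewrite -mulr_sumr exchange_big /= /a divfK ?gt_eqF //.
  rewrite (eq_bigr (fun=> 1)); last by move=> u /andP[/sump].
  rewrite ler_wpM2l ?(ltW s0) // sumr_const; apply: le_trans Nd.
  by rewrite ler_nat; apply/subset_leq_card/subsetP => u /andP[].
(* Jensen for exp through its tangent line at [- a]. *)
have tangent c : w c * (expR (- a) * (1 + (a - y c))) <= w c * expR (- y c).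
  apply: ler_wpM2l => //; rewrite -[in leRHS](addKr a (- y c)) expRD.
  by apply: ler_wpM2l; rewrite ?expR_ge0 ?expR_ge1Dx.
apply: le_trans (ler_sum _ (fun c _ => tangent c)).
have -> : \sum_c w c * (expR (- a) * (1 + (a - y c))) =
    expR (- a) * ((1 + a) * (\sum_c w c) - \sum_c w c * y c).
  rewrite mulr_sumr -sumrB mulr_sumr; apply: eq_bigr => c _; ring.
rewrite mulrC ler_wpM2l ?expR_ge0 //.
have a0 : 0 <= a.
  apply: divr_ge0 (ltW W00); apply: mulr_ge0 (ltW s0) _.
  exact: le_trans (ler0n _ _) Nd.
have : a * W0 <= a * \sum_c w c by apply: ler_wpM2l.
by lra.
Qed.

End LocalEstimate.

(** * Counting proper colorings by resampling an independent neighborhood *)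

Section Counting.
Variables (R : realType) (T C : finType) (e : rel T).
Hypotheses (e_sym : symmetric e) (e_irr : irreflexive e).
Hypothesis e_tri : triangle_free e.
Implicit Types (S N : {set T}) (u v : T) (f g : {ffun T -> C}).

Definition proper S f :=
  [forall x in S, forall y in S, e x y ==> (f x != f y)].

Definition avail S f u := [set c | [forall w in S, e u w ==> (f w != c)]].

Definition merge N f g : {ffun T -> C} :=
  [ffun x => if x \in N then g x else f x].

Definition independent N := {in N &, forall x y, ~~ e x y}.

Lemma properP S f :
  reflect {in S &, forall x y, e x y -> f x != f y} (proper S f).
Proof.
apply: (iffP 'forall_in_'forall_in_implyP) => h x y; first by move=> ? ?; apply: h.
by move=> xS y' yS; apply: h.
Qed.

Lemma availP S f u c :
  reflect {in S, forall w, e u w -> f w != c} (c \in avail S f u).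
Proof. by rewrite inE; apply: 'forall_in_implyP. Qed.

Lemma avail_indep S N f u :
  {in N, forall w, ~~ e u w} -> avail (S :\: N) f u = avail S f u.
Proof.
move=> ind; apply/setP => c; apply/availP/availP => h w; last first.
  by move=> /setDP[wS _]; apply: h.
move=> wS uw; apply: h => //; rewrite inE wS andbT.
by apply: contraL uw => /ind.
Qed.

(** No edge lies inside [N], so the constraints on the values of [f] on [N] separate vertex by
    vertex. *)
Lemma proper_setD S N f : N \subset S -> independent N ->
  proper S f =
    proper (S :\: N) f && [forall u in N, f u \in avail S f u].
Proof.
move=> NS ind; apply/properP/andP => [h|[/properP h /forall_inP hN] x y xS yS xy].
  split; first by apply/properP => x y /setDP[xS _] /setDP[yS _]; apply: h.
  apply/forall_inP => u uN; apply/availP => w wS uw.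
  by rewrite eq_sym h // (subsetP NS).
have [xN|xN] := boolP (x \in N).
  by rewrite eq_sym; have /availP := hN x xN; apply.
have [yN|yN] := boolP (y \in N).
  by have /availP := hN y yN; apply; rewrite // e_sym.
by apply: h; rewrite ?inE ?xN ?yN.
Qed.

Lemma proper_merge S N f g : proper (S :\: N) (merge N f g) = proper (S :\: N) f.
Proof.
apply/properP/properP => h x y xS yS xy; have := h x y xS yS xy; rewrite !ffunE;
by move: xS yS; rewrite !inE => /andP[/negPf -> _] /andP[/negPf -> _].
Qed.

Lemma avail_merge S N f g u :
  {in N, forall w, ~~ e u w} -> avail S (merge N f g) u = avail S f u.
Proof.
move=> ind; apply/setP => c; apply/availP/availP => h w wS uw;
  have := h w wS uw; rewrite ffunE; case: ifP => // /ind; by rewrite uw.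
Qed.

(* Exchanging the values of [f] and [g] on [N] is an involution. *)
Lemma sum_merge N (G : {ffun T -> C} -> R) :
  #|{ffun T -> C}|%:R * \sum_f G f = \sum_f \sum_g G (merge N f g).
Proof.
rewrite mulrC mulr_suml.
under eq_bigr => f _ do rewrite mulr_natr -[#|_|]/(#|predT|) -sumr_const.
rewrite !pair_big /=.
pose h (p : {ffun T -> C} * {ffun T -> C}) := (merge N p.1 p.2, merge N p.2 p.1).
rewrite (reindex_inj (h := h)) //=.
apply: (can_inj (g := h)) => -[f g]; rewrite /h /=.
by congr pair; apply/ffunP => x; rewrite !ffunE; case: (x \in N).
Qed.

Lemma sum_ffun_in N (L : T -> {set C}) :
  (0 < #|C|)%N ->
  \sum_(g : {ffun T -> C}) \prod_(u in N) (g u \in L u)%:R =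
  #|{ffun T -> C}|%:R * \prod_(u in N) (#|L u|%:R / #|C|%:R) :> R.
Proof.
move=> C0; have k0 : (#|C|%:R : R) != 0 by rewrite pnatr_eq0 -lt0n.
transitivity (\prod_u \sum_c (if u \in N then (c \in L u)%:R else 1 : R)).
  by rewrite bigA_distr_bigA; apply: eq_bigr => g _; rewrite big_mkcond.
have -> : #|{ffun T -> C}|%:R = \prod_(u : T) (#|C|%:R : R).
  by rewrite prodr_const card_ffun natrX.
rewrite [X in _ * X]big_mkcond -big_split /=; apply: eq_bigr => u _.
case: ifP => _; last by rewrite sumr_const mulr1.
rewrite mulrC mulfVK // -natr_sum -sum1_card [in RHS]big_mkcond /=.
by congr (_%:R); apply: eq_bigr => c _; case: ifP.
Qed.

(** Given [f] off [N], the values on [N] of a random function proper on [S] are independent and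
    uniform in the sets [avail S f u]; [H] must not depend on these values, so that it factors
    out. *)
Lemma sum_proper_merge S N (H : {ffun T -> C} -> R) (X : T -> {set C}) :
    (0 < #|C|)%N -> N \subset S -> independent N ->
    (forall f g, H (merge N f g) = H f) ->
  \sum_f (proper S f)%:R * H f * \prod_(u in N) (f u \in X u)%:R =
  \sum_f (proper (S :\: N) f)%:R * H f *
    \prod_(u in N) (#|avail S f u :&: X u|%:R / #|C|%:R).
Proof.
move=> C0 NS ind Hm.
have O0 : (#|{ffun T -> C}|%:R : R) != 0.
  by rewrite pnatr_eq0 -lt0n card_ffun expn_gt0 C0.
apply: (mulfI O0); rewrite (sum_merge N) mulr_sumr; apply: eq_bigr => f _.
transitivity (\sum_(g : {ffun T -> C}) (proper (S :\: N) f)%:R * H f *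
    \prod_(u in N) (g u \in avail S f u :&: X u)%:R).
  apply: eq_bigr => g _; rewrite Hm (proper_setD _ NS ind) proper_merge.
  rewrite -mulnb natrM [_ * H f]mulrAC -[LHS]mulrA; congr (_ * _).
  have -> : [forall u in N, merge N f g u \in avail S (merge N f g) u]%:R =
      \prod_(u in N) (g u \in avail S f u)%:R :> R.
    have eqm u : u \in N -> (merge N f g u \in avail S (merge N f g) u) =
        (g u \in avail S f u).
      by move=> uN; rewrite avail_merge ?ffunE ?uN // => w wN; apply: ind.
    have [/forall_inP h|/forall_inPn[u uN nu]] :=
        boolP [forall u in N, merge N f g u \in avail S (merge N f g) u].
      by rewrite big1 // => u uN; rewrite -eqm // h.
    by rewrite (bigD1 u) //= -eqm // (negPf nu) mul0r.
  rewrite -big_split /=; apply: eq_bigr => u uN.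
  by rewrite ffunE uN in_setI -natrM mulnb.
by rewrite -mulr_sumr sum_ffun_in // mulrCA.
Qed.

(** Values off [S] are free, so [count S] is the number of proper colorings of [S] alone times
    [#|C| ^ (#|T| - #|S|)]. Thus [l * count (S :\ v) <= #|C| * count S] says that adding [v]
    multiplies the number of partial colorings by at least [l]. *)
Definition count S : R := \sum_f (proper S f)%:R.

Lemma count_extend S v : (0 < #|C|)%N -> v \in S ->
  #|C|%:R * count S =
    \sum_f (proper (S :\ v) f)%:R * #|avail (S :\ v) f v|%:R.
Proof.
move=> C0 vS.
have k0 : (#|C|%:R : R) != 0 by rewrite pnatr_eq0 -lt0n.
have ind : independent [set v] by move=> x y /set1P-> /set1P->; rewrite e_irr.
have := @sum_proper_merge S [set v] (fun=> 1) (fun=> setT) C0 _ ind (fun _ _ => erefl).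
rewrite sub1set => /(_ vS) E.
have -> : count S =
    \sum_f (proper S f)%:R * 1 * \prod_(u in [set v]) (f u \in [set: C])%:R.
  by apply: eq_bigr => f _; rewrite big_set1 inE !mulr1.
rewrite E mulr_sumr; apply: eq_bigr => f _.
rewrite big_set1 setIT mulr1 mulrCA [_ * (_ / _)]mulrC divfK // avail_indep //.
by move=> w /set1P->; rewrite e_irr.
Qed.

(** Once the colors off [u] are fixed, at most [t] of the [#|C|] values at [u] count. The assumed
    ratio bound then turns [count (S :\ u)] into [count S]. *)
Lemma count_few_avail S u (l : R) (t : nat) : (0 < #|C|)%N -> u \in S -> 0 < l ->
    l * count (S :\ u) <= #|C|%:R * count S ->
  \sum_f (proper S f)%:R * (#|avail S f u| <= t)%N%:R <= t%:R / l * count S.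
Proof.
move=> C0 uS l0 IH.
have k0 : 0 < (#|C|%:R : R) by rewrite ltr0n.
have ind : independent [set u] by move=> x y /set1P-> /set1P->; rewrite e_irr.
pose H f : R := (#|avail S f u| <= t)%N%:R.
have Hm f g : H (merge [set u] f g) = H f.
  by rewrite /H avail_merge // => w /set1P->; rewrite e_irr.
have := @sum_proper_merge S [set u] H (fun=> setT) C0 _ ind Hm.
rewrite sub1set => /(_ uS) E.
have -> : \sum_f (proper S f)%:R * H f =
    \sum_f (proper S f)%:R * H f * \prod_(w in [set u]) (f w \in [set: C])%:R.
  by apply: eq_bigr => f _; rewrite big_set1 inE !mulr1.
rewrite E; apply: (@le_trans _ _ (\sum_f (proper (S :\ u) f)%:R * (t%:R / #|C|%:R))).
  apply: ler_sum => f _; rewrite big_set1 setIT -mulrA ler_wpM2l // /H.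
  case: leqP => [le|_]; last by rewrite mul0r divr_ge0.
  by rewrite mul1r ler_pM2r ?invr_gt0 // ler_nat.
rewrite -mulr_suml -[X in X * _]/(count (S :\ u)) mulrC -!mulrA ler_wpM2l //.
by rewrite ler_pdivrMl // mulrCA ler_pdivlMl.
Qed.

Lemma count_ge0 S : 0 <= count S.
Proof. by apply: sumr_ge0. Qed.

Variables (d b l : R) (t : nat).
Hypotheses (C_gt0 : (0 < #|C|)%N) (t_gt0 : (0 < t)%N) (b_gt0 : 0 < b) (b_lt1 : b < 1).
Hypothesis l_gt0 : 0 < l.
Hypothesis deg : forall v, #|[set u | e v u]|%:R <= d.
(** The average number of bad neighbors, at most [d * t / l], is thereby at most half of the
    threshold [b * #|C|]. Markov then loses a factor 2, which the 2 in [many_avail] pays for. *)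
Hypothesis few_bad : 2 * d * t%:R <= l * (b * #|C|%:R).
Hypothesis many_avail : 2 * l <= (1 - b) * #|C|%:R *
  expR (- ((1 + t%:R^-1) * d / ((1 - b) * #|C|%:R))).

Lemma count_step S v : v \in S ->
    (forall u, u \in S :\ v ->
       l * count (S :\ v :\ u) <= #|C|%:R * count (S :\ v)) ->
  l * count (S :\ v) <= #|C|%:R * count S.
Proof.
move=> vS IH; rewrite (count_extend C_gt0 vS); move: IH; set S' := S :\ v => IH.
have k0 : 0 < (#|C|%:R : R) by rewrite ltr0n.
pose N := [set u in S' | e v u].
have NS : N \subset S' by apply/subsetP => u; rewrite inE => /andP[].
have ind : independent N.
  move=> x y; rewrite !inE => /andP[_ vx] /andP[_ vy]; apply/negP => xy.
  by apply: (@e_tri v x y); rewrite (e_sym y v).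
have Nd : #|N|%:R <= d.
  apply: le_trans (deg v); rewrite ler_nat; apply/subset_leq_card/subsetP => u.
  by rewrite !inE => /andP[].
pose bad f := #|[set u in N | (#|avail S' f u| <= t)%N]|.
(* [H] indicates few bad neighbors. It ignores the values on [N]: the colors available in [N] depend
   only on [f] off [N], as [N] is independent. *)
pose H f : R := ((bad f)%:R <= b * #|C|%:R :> R)%:R.
have Hm f g : H (merge N f g) = H f.
  rewrite /H; suff -> : bad (merge N f g) = bad f by [].
  apply: eq_card => u; rewrite [LHS]inE [RHS]inE.
  by case uN: (u \in N) => //=; rewrite avail_merge // => w; apply: ind.
have := many_avail; set M := (1 - b) * _ * expR _ => lM.
have availE f : (#|avail S' f v|%:R : R) = \sum_c \prod_(u in N) (f u \in [set~ c])%:R.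
  rewrite -sum1_card natr_sum big_mkcond /=; apply: eq_bigr => c _.
  case: availP => h.
    by rewrite big1 // => u; rewrite inE => /andP[uS vu]; rewrite !inE h.
  have [u uN fu] : exists2 u, u \in N & f u == c.
    apply/exists_inP; apply: contra_notT h => /exists_inPn h w wS vw.
    by apply: h; rewrite inE wS.
  by rewrite (bigD1 u) //= !inE fu mul0r.
(* Markov's inequality: at least half of the functions proper on [S'] have few bad neighbors. *)
have good : count S' / 2 <= \sum_f (proper S' f)%:R * H f.
  have markov : (b * #|C|%:R) * \sum_f (proper S' f)%:R * (1 - H f) <=
      \sum_f (proper S' f)%:R * (bad f)%:R.
    rewrite mulr_sumr; apply: ler_sum => f _; rewrite mulrCA ler_wpM2l // /H.
    case: (leP (bad f)%:R (b * #|C|%:R)) => [_|/ltW le] /=; first by rewrite subrr mulr0.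
    by rewrite subr0 mulr1.
  have badE : \sum_f (proper S' f)%:R * (bad f)%:R <= d * (t%:R / l * count S').
    have -> : \sum_f (proper S' f)%:R * (bad f)%:R =
        \sum_(u in N) \sum_f (proper S' f)%:R * (#|avail S' f u| <= t)%N%:R :> R.
      rewrite [RHS]exchange_big /=; apply: eq_bigr => f _; rewrite -mulr_sumr.
      rewrite -natr_sum /bad -sum1dep_card big_mkcondr /=.
      by congr (_ * _%:R); apply: eq_bigr => u _; case: ifP.
    apply: (@le_trans _ _ (\sum_(u in N) (t%:R / l * count S'))).
      apply: ler_sum => u /(subsetP NS) uS.
      by apply: count_few_avail => //; apply: IH.
    rewrite sumr_const -[leLHS]mulr_natl ler_wpM2r //.
    by rewrite mulr_ge0 ?count_ge0 // divr_ge0 // ltW.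
  have cE : \sum_f (proper S' f)%:R * (1 - H f) =
      count S' - \sum_f (proper S' f)%:R * H f.
    by rewrite -sumrB; apply: eq_bigr => f _; rewrite mulrBr mulr1.
  have bk : 0 < b * #|C|%:R by rewrite mulr_gt0.
  have : (b * #|C|%:R) * (count S' - \sum_f (proper S' f)%:R * H f) <=
      (b * #|C|%:R) * (count S' / 2).
    rewrite -cE; apply: le_trans markov (le_trans badE _).
    have : d * (t%:R / l) <= b * #|C|%:R / 2 
      by rewrite mulrA ler_pdivrMr //; move: few_bad; lra.
    by move=> /(ler_wpM2r (count_ge0 S')); lra.
  by rewrite ler_pM2l //; lra.
apply: (@le_trans _ _ (M * \sum_f (proper S' f)%:R * H f)).
  apply: (@le_trans _ _ (M * (count S' / 2))).
    by have := ler_wpM2r (count_ge0 S') lM; lra.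
  by apply: ler_wpM2l good; move: l_gt0 lM; lra.
apply: (@le_trans _ _ (\sum_f (proper S' f)%:R * H f * #|avail S' f v|%:R)); last first.
  apply: ler_sum => f _; rewrite -mulrA ler_wpM2l // ler_piMl //.
  by rewrite /H lern1 leq_b1.
(* Sum over the colors [c] first, then resample [N] under the condition that [c] is avoided
   there. *)
rewrite [leRHS](_ : _ = \sum_c \sum_f (proper S' f)%:R * H f *
    \prod_(u in N) (f u \in [set~ c])%:R); last first.
  rewrite exchange_big /=; apply: eq_bigr => f _.
  by rewrite availE mulr_sumr.
under [leRHS]eq_bigr => c _ do rewrite (@sum_proper_merge S' N H (fun=> [set~ c])) //.
rewrite [leRHS]exchange_big /=.
(* The left side is resampled as well, without restriction on the colors, so that both sides are
   sums over the same [f] and can be compared term by term. *)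
rewrite [X in M * X](_ : _ = \sum_f (proper S' f)%:R * H f *
    \prod_(u in N) (f u \in [set: C])%:R); last first.
  by apply: eq_bigr => f _; rewrite big1 ?mulr1 // => u _; rewrite inE.
rewrite (@sum_proper_merge S' N H (fun=> setT)) // mulr_sumr.
apply: ler_sum => f _; rewrite -mulr_sumr mulrCA -[leLHS]mulrA -[leRHS]mulrA ler_wpM2l //.
rewrite /H; have [badf|_] := leP (bad f)%:R (b * #|C|%:R); last by rewrite !mul0r.
rewrite !mul1r.
under [leRHS]eq_bigr => c _ do rewrite prodf_div.
rewrite prodf_div -mulr_suml mulrA ler_wpM2r ?invr_ge0 ?prodr_ge0 //.
under eq_bigr => u _ do rewrite setIT.
under [leRHS]eq_bigr => c _ do under eq_bigr => u _ do rewrite -setDE.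
exact: sum_prod_avoid_ge.
Qed.

Lemma count_leq S v : v \in S -> l * count (S :\ v) <= #|C|%:R * count S.
Proof.
have [n] := ubnP #|S|; elim: n => // n IH in S v *; rewrite ltnS => Sn vS.
apply: count_step => // u uS; apply: IH => //.
by apply: leq_trans Sn; rewrite [leqRHS](cardsD1 v) vS.
Qed.

Lemma count_gt0 S : 0 < count S.
Proof.
have [n] := ubnP #|S|; elim: n => // n IH in S *; rewrite ltnS => Sn.
have [->|[v vS]] := set_0Vmem S.
  rewrite /count (eq_bigr (fun=> 1)) ?sumr_const => [|f _].
    by rewrite ltr0n card_ffun expn_gt0 C_gt0.
  by rewrite (introT (properP _ _)) // => x; rewrite inE.
have : 0 < l * count (S :\ v).
  rewrite mulr_gt0 // IH //.
  by apply: leq_trans Sn; rewrite [leqRHS](cardsD1 v) vS.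
by move=> /lt_le_trans/(_ (count_leq vS)); rewrite pmulr_rgt0 // ltr0n.
Qed.

Lemma exists_proper_coloring : exists f : T -> C, forall x y, e x y -> f x != f y.
Proof.
have [/existsP[f /properP h]|/existsPn h] := boolP [exists f, proper setT f].
  by exists f => x y; apply: h.
have := count_gt0 setT; rewrite /count big1 ?ltxx // => f _.
by rewrite (negPf (h f)).
Qed.

End Counting.

(** * Choice of parameters for large maximum degree *)

Section Asymptotics.
Variable R : realType.

Lemma expR_ge_pow (x : R) (n : nat) : 0 <= x -> (x / n.+1%:R) ^+ n.+1 <= expR x.
Proof.
move=> x0; have -> : expR x = expR (x / n.+1%:R) ^+ n.+1.
  by rewrite -expRM_natr divfK // pnatr_eq0.
have y0 : 0 <= x / n.+1%:R by rewrite divr_ge0.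
rewrite ler_pXn2r ?nnegrE ?expR_ge0 //.
by apply: le_trans (expR_ge1Dx _); rewrite lerDr.
Qed.

(** [l] makes [few_bad] an equality for [d = D / 2], and is of order [ln D]. The number of free
    colors is at least of order [D] to the power [b], up to a factor [ln D], hence exceeds [2 * l]
    for large [D]. *)
Lemma counting_parameters (eps : R) : 0 < eps ->
  exists (t : nat) (b : R) (D0 : nat), [/\ (0 < t)%N, 0 < b, b < 1 &
    forall n : nat, (D0 <= n)%N ->
      let D : R := n%:R in
      let k := Num.truncn ((1 + eps) * (D / (2 * ln D))) in
      let l := D * t%:R / (b * k%:R) in
      [/\ k%:R <= (1 + eps) * (D / (2 * ln D)), (0 < k)%N, 0 < l &
        2 * l <= (1 - b) * k%:R *
          expR (- ((1 + t%:R^-1) * (D / 2) / ((1 - b) * k%:R)))]].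
Proof.
move=> eps0; set r : R := 1 + eps / 2.
have r1 : 1 < r by rewrite /r; lra.
pose s := 1 - r^-1.
have rV1 : r^-1 < 1 by rewrite invf_lt1 //; lra.
have rV0 : 0 < r^-1 by rewrite invr_gt0; lra.
have s0 : 0 < s by rewrite /s; lra.
have s1 : s < 1 by rewrite /s; lra.
(* Chosen so that [1 + t^-1 <= (1 - b) ^+ 2 * r], which reduces to [(1 + s / 2) * (1 - s) <= (1 - s
   / 4) ^+ 2]. *)
pose b := s / 4; pose t := (Num.truncn (2 / s)).+1.
have b0 : 0 < b by rewrite /b; lra.
have b1 : b < 1 by rewrite /b; lra.
have tV : t%:R^-1 <= s / 2.
  rewrite -[s / 2]invrK lef_pV2 ?posrE ?invr_gt0 ?divr_gt0 ?ltr0n //.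
  by rewrite invf_div; apply/ltW/truncnS_gt.
have t0 : 0 < (t%:R : R) by rewrite ltr0n.
have b40 : 0 < b ^+ 4 * (1 - b) by rewrite mulr_gt0 ?exprn_gt0 // subr_gt0.
(* A lower bound for [ln D]: the summands give in turn [1 <= L], room for the truncation in [k], and
   the final comparison with [2 * l]. *)
pose K := 1 + 16 / eps + 216 * t%:R / (b ^+ 4 * (1 - b)).
have K1 : 0 <= 16 / eps by rewrite divr_ge0 // ltW.
have K2 : 0 <= 216 * t%:R / (b ^+ 4 * (1 - b)).
  by rewrite divr_ge0 ?(ltW b40) // mulr_ge0.
exists t, b, (Num.truncn (expR K)).+1; split=> // n nD D k l.
have D1 : expR K <= D.
  by apply: le_trans (ltW (truncnS_gt _)) _; rewrite ler_nat.
have D0 : 0 < D := lt_le_trans (expR_gt0 _) D1.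
set L := ln D in k l *.
have DL : D = expR L by rewrite lnK.
have KL : K <= L by rewrite -ler_expR -DL.
have L1 : 1 <= L by apply: le_trans KL; rewrite /K; lra.
have L0 : 0 < L by lra.
have L16 : 16 <= L * eps.
  by rewrite -ler_pdivrMr //; apply: le_trans KL; rewrite /K; lra.
have L216 : 216 * t%:R <= L * (b ^+ 4 * (1 - b)).
  by rewrite -ler_pdivrMr //; apply: le_trans KL; rewrite /K; lra.
have D2 : (L / 2) ^+ 2 <= D by rewrite DL; apply: (@expR_ge_pow _ 1); lra.
set Z := D / (2 * L).
have Z0 : 0 < Z by rewrite divr_gt0 ?mulr_gt0.
have ZD : Z * L = D / 2.
  by rewrite /Z invfM mulrA divfK // gt_eqF.
(* Truncation loses less than 1, so half of [eps] absorbs it and [r * Z <= k] remains. *)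
have Zeps : 1 <= eps / 2 * Z.
  rewrite -(ler_pM2r L0) mul1r -[leRHS]mulrA ZD.
  by have := ler_wpM2l (ltW eps0) D2; have := ler_wpM2r (ltW L0) L16; lra.
have X0 : 0 <= (1 + eps) * Z by rewrite mulr_ge0 ?ltW //; lra.
have /andP[kX] := truncn_itv X0; rewrite -/k -natr1 => Xk.
have kY : r * Z <= k%:R by rewrite /r; lra.
have kZ : Z <= k%:R by apply: le_trans kY; rewrite ler_peMl ?ltW.
have k0 : 0 < (k%:R : R) by lra.
have bk0 : 0 < b * k%:R by rewrite mulr_gt0.
have bk1 : 0 < (1 - b) * k%:R by rewrite mulr_gt0 // subr_gt0.
split=> //; first by rewrite -(ltr0n R).
  by rewrite /l divr_gt0 // mulr_gt0.
have aL : (1 + t%:R^-1) * (D / 2) / ((1 - b) * k%:R) <= (1 - b) * L.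
  rewrite ler_pdivrMr // -ZD.
  have tb : 1 + t%:R^-1 <= (1 - b) ^+ 2 * r.
    rewrite -ler_pdivrMr; last by lra.
    have -> : r^-1 = 1 - s by rewrite /s; lra.
    apply: (@le_trans _ _ ((1 + s / 2) * (1 - s))).
      by apply: ler_wpM2r; lra.
    by rewrite /b; nra.
  have h1 : (1 + t%:R^-1) * (Z * L) <= (1 - b) ^+ 2 * r * (Z * L).
    by apply: ler_wpM2r => //; rewrite mulr_ge0 // ltW.
  have h2 : (1 - b) ^+ 2 * L * (r * Z) <= (1 - b) ^+ 2 * L * k%:R.
    by apply: ler_wpM2l => //; rewrite mulr_ge0 ?sqr_ge0 // ltW.
  by lra.
set a := _ / ((1 - b) * k%:R) in aL *.
(* A cube is enough: [Z ^+ 2] costs [L ^+ 2], so one factor [L] survives to beat the constants; 108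
   below is 4 times 27. *)
have E : D^-1 * (b * L / 3) ^+ 3 <= expR (- a).
  apply: (@le_trans _ _ (expR (- ((1 - b) * L)))); last by rewrite ler_expR lerN2.
  have -> : - ((1 - b) * L) = - L + b * L by ring.
  rewrite expRD expRN -DL; apply: ler_wpM2l; first by rewrite invr_ge0 ltW.
  by apply: (@expR_ge_pow _ 2); rewrite mulr_ge0 // ltW.
rewrite /l mulrA ler_pdivrMr //.
have kk : Z ^+ 2 <= k%:R ^+ 2 by rewrite ler_pXn2r ?nnegrE // ltW.
have h3 : (1 - b) * b * Z ^+ 2 * (D^-1 * (b * L / 3) ^+ 3) <=
    (1 - b) * b * k%:R ^+ 2 * expR (- a).
  have bb : 0 <= (1 - b) * b by apply: mulr_ge0; lra.
  apply: ler_pM => //.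
  - by rewrite mulr_ge0 ?sqr_ge0.
  - apply: mulr_ge0; first by rewrite invr_ge0 ltW.
    by apply: exprn_ge0; apply: divr_ge0 => //; apply: mulr_ge0; lra.
  - exact: ler_wpM2l.
have h4 : (1 - b) * b * Z ^+ 2 * (D^-1 * (b * L / 3) ^+ 3) =
    D * (L * (b ^+ 4 * (1 - b)) / 108).
  by rewrite /Z; field; rewrite ?gt_eqF.
have h5 : D * (2 * t%:R) <= D * (L * (b ^+ 4 * (1 - b)) / 108).
  by apply: ler_wpM2l; lra.
lra.
Qed.

End Asymptotics.

Theorem mainTheorem8 (R : realType) (eps : R) (heps : 0 < eps) :
  exists Delta0 : nat,
    forall (T : finType) (e : rel T),
      symmetric e -> irreflexive e -> triangle_free e ->
      (Delta0 <= max_degree e)%N ->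
      (oriented_chi e)%:R <=
        (1 + eps) * ((max_degree e)%:R / (2 * ln (max_degree e)%:R)) :> R.
Proof.
have [t [b [D0 [t0 b0 b1 params]]]] := counting_parameters heps.
exists D0 => T e _ e_irr e_tri /params /= [kX k0 l0 many]; apply: le_trans kX.
rewrite ler_nat; apply/bigmax_leqP => D oD.
apply: (dichromatic_leq_sparse_coloring oD) => B B_sym Be B_deg.
(* The sparse graph [B] has degrees at most half of the maximum degree of [e], which is the source
   of the 2 in the denominator. *)
apply: (exists_proper_coloring _ _ _ _ t0 b0 b1 l0 _ _ (d := (max_degree e)%:R / 2)).
- exact: B_sym.
- by move=> x; apply/negP => /Be; rewrite e_irr.
- by move=> x y z [/Be xy /Be yz /Be zx]; apply: (e_tri x y z).
- by rewrite card_ord.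
- move=> v; rewrite ler_pdivlMr // -natrM ler_nat mulnC.
  by apply: leq_trans (B_deg v) _; rewrite leq_bigmax.
- rewrite card_ord divfK; last by rewrite gt_eqF // mulr_gt0 // ltr0n.
  by lra.
- by rewrite card_ord.
Qed.
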